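(* Let $G$ be an abelian group, $\phi\in\mathrm{End}(G)$, and let $F$ be a non-empty finite subset of $G$. Then $H(\phi,F)>0$ if and only if $\phi$ has exponential growth with respect to $F$, and $H(\phi,F)=0$ if and only if $\phi$ has polynomial growth with respect to $F$.
   Context: $\mathbb N_+=\{1,2,\dots\}$. For a non-empty finite subset $F$ of $G$ and $n\in\mathbb N_+$ put $T_n(\phi,F)=F+\phi(F)+\dots+\phi^{n-1}(F)$ and $\tau_{\phi,F}(n)=|T_n(\phi,F)|$. The limit $H(\phi,F)=\lim_{n\to\infty}\frac{\log\tau_{\phi,F}(n)}{n}$ exists. $\phi$ has exponential growth with respect to $F$ if there exists $b\in\mathbb R$, $b>1$, such that $\tau_{\phi,F}(n)\ge b^n$ for every $n\in\mathbb N_+$. $\phi$ has polynomial growth with respect to $F$ if there exists $P_F(x)\in\mathbb Z[x]$ such that $\tau_{\phi,F}(n)\le P_F(n)$ for every $n\in\mathbb N_+$. *)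

(* Defs.v *)
From mathcomp Require Import all_boot all_order all_algebra.
From mathcomp Require Import finmap.
From mathcomp Require Import all_classical all_reals all_analysis.

Set Implicit Arguments.
Unset Strict Implicit.
Unset Printing Implicit Defensive.

Import Order.TTheory GRing.Theory Num.Theory.
Import numFieldNormedType.Exports.

Local Open Scope ring_scope.

Definition fset_add (G : zmodType) (A B : {fset G}) : {fset G} :=
  [fset (a + b)%R | a in A, b in B]%fset.

(* F + phi(F) + ... + phi^(n-1)(F); the empty sum (n = 0) is {0}, the neutral
   element of the Minkowski sum. *)
Definition trajectory (G : zmodType) (phi : {additive G -> G}) (F : {fset G})
    (n : nat) : {fset G} :=
  \big[@fset_add G/[fset 0]%fset]_(i < n) [fset iter i phi x | x in F]%fset.

Definition tau (G : zmodType) (phi : {additive G -> G}) (F : {fset G})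
    (n : nat) : nat := #|` trajectory phi F n|%fset.

(* [limn] is total; tau is submultiplicative, so the limit exists (Fekete) when F
   is non-empty. The n = 0 term is irrelevant. *)
Definition algebraic_entropy (R : realType) (G : zmodType)
    (phi : {additive G -> G}) (F : {fset G}) : R :=
  limn (fun n : nat => ln ((tau phi F n)%:R : R) / n%:R).

Definition exponential_growth (R : realType) (G : zmodType)
    (phi : {additive G -> G}) (F : {fset G}) : Prop :=
  exists b : R, 1 < b /\
    forall n : nat, (0 < n)%N -> b ^+ n <= (tau phi F n)%:R.

Definition polynomial_growth (G : zmodType)
    (phi : {additive G -> G}) (F : {fset G}) : Prop :=
  exists P : {poly int},
    forall n : nat, (0 < n)%N -> (tau phi F n)%:Z <= P.[n%:Z].

(* Main.v *)
Require Import Defs.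
From HB Require Import structures.
From mathcomp Require Import all_boot all_order all_algebra algC.
From mathcomp Require Import finmap.
From mathcomp Require Import all_classical all_reals all_analysis.
From mathcomp Require Import zify ring lra.

Import Order.TTheory GRing.Theory Num.Theory.
Import numFieldNormedType.Exports.

Local Open Scope ring_scope.

(** Two of the four implications are easy: exponential growth with base [b]
    forces the entropy to be at least [ln b], and polynomial growth forces it
    to vanish.  What makes the theorem true is a dichotomy, [tau_dichotomy]: a
    trajectory grows exponentially or polynomially, with nothing in between.

    Fix [f0] in [F].  Up to translation, the trajectory of [F] lies in the sum
    of the trajectories of the pairs [{0, f - f0}], and each of these embeds in
    the trajectory of [F] ([tau_le_prod], [tau_pair_le]).  So it suffices to
    bound polynomially the growth of one pair [{0, g}] when no subsequence
    [tau (k * n)] dominates [2 ^ n].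

    View [G] as a module over the ring of integer polynomials, ['X] acting as
    [phi].  If [tau (k * n) < 2 ^ n] for some [n], the pigeonhole principle
    yields two distinct sets of indices [i < n] over which the elements
    [phi^(k i) g] have the same sum, i.e. a non-zero polynomial in ['X^k] with
    coefficients in [{-1, 0, 1}] which kills [g] ([small_annihilatorP]).  For
    [k = 1] it has leading coefficient [1] or [-1], so that the orbit of [g] spans a finitely
    generated group.  In general its roots [z] satisfy [`|z| ^ k < 2].  Let [q]
    be the primitive part of a non-zero polynomial of least degree which kills
    [g].  It divides all the annihilators of [g], hence its leading coefficient
    is a unit and its complex roots lie in the closed unit disc
    ([annihilator_structure]).  The coefficients of ['X^n] modulo [q] obey a
    linear recurrence whose characteristic roots are those of [q], so they grow
    at most polynomially in [n] ([modXn_bound]).  The multiples of [q] act on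
    [g] through a finite group, because [q] sends [g] to a torsion element of
    the finitely generated group above.  Counting remainders modulo [q], times that finite group, gives the
    polynomial bound ([tau_pair_poly_bounded]).  *)

(** * Minkowski sums and trajectories *)

Lemma fset_addP {G : zmodType} {A B : {fset G}} {x : G} :
  reflect (exists2 a, a \in A & exists2 b, b \in B & x = a + b)
          (x \in fset_add A B).
Proof. exact: imfset2P. Qed.

Lemma mem_fset_add {G : zmodType} {A B : {fset G}} {a b : G} :
  a \in A -> b \in B -> a + b \in fset_add A B.
Proof. by move=> aA bB; apply/fset_addP; exists a => //; exists b. Qed.

Lemma fset_addA (G : zmodType) : associative (@fset_add G).
Proof.
move=> A B C; apply/fsetP => x; apply/fset_addP/fset_addP.
- move=> [a aA [y /fset_addP[b bB [c cC ->]] ->]]; exists (a + b).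
    exact: mem_fset_add.
  by exists c; rewrite ?addrA.
- move=> [y /fset_addP[a aA [b bB ->]] [c cC ->]]; exists a => //.
  by exists (b + c); rewrite ?addrA ?mem_fset_add.
Qed.

Lemma fset_addC (G : zmodType) : commutative (@fset_add G).
Proof.
move=> A B; apply/fsetP => x; apply/fset_addP/fset_addP;
  by move=> [a aA [b bB ->]]; exists b => //; exists a; rewrite // addrC.
Qed.

Lemma fset_add0 (G : zmodType) : left_id [fset 0]%fset (@fset_add G).
Proof.
move=> A; apply/fsetP => x; apply/fset_addP/idP.
  by move=> [a /fset1P-> [b bB ->]]; rewrite add0r.
by move=> xA; exists 0; [exact/fset1P|exists x; rewrite ?add0r].
Qed.

(** This instance gives access to the splitting lemmas for the iterated sum
    that defines trajectories. *)
HB.instance Definition _ (G : zmodType) :=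
  Monoid.isComLaw.Build {fset G} [fset 0]%fset (@fset_add G)
    (@fset_addA G) (@fset_addC G) (@fset_add0 G).

Lemma card_fset_add {G : zmodType} (A B : {fset G}) :
  (#|` fset_add A B| <= #|` A| * #|` B|)%N.
Proof.
pose P := [seq (a + b)%R | a <- enum_fset A, b <- enum_fset B].
rewrite -(size_allpairs (fun a b => (a + b)%R)).
apply: uniq_leq_size; first exact: fset_uniq.
move=> x /fset_addP[a aA [b bB ->]].
exact: (allpairs_f (fun a b => (a + b)%R)).
Qed.

Lemma leq_card_fset_addr {G : zmodType} {A B : {fset G}} {b : G} :
  b \in B -> (#|` A| <= #|` fset_add A B|)%N.
Proof.
move=> bB.
have <- : #|` [fset (a + b)%R | a in A]%fset| = #|` A|.
  by apply: card_imfset; exact: addIr.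
apply: fsubset_leq_card; apply/fsubsetP => x /imfsetP[a aA ->].
exact: mem_fset_add.
Qed.

Lemma leq_card_image {T U : choiceType} (f : T -> U) (A : {fset T}) :
  (#|` [fset f x | x in A]%fset| <= #|` A|)%N.
Proof.
rewrite -[leqRHS](size_map f); apply: uniq_leq_size; first exact: fset_uniq.
by move=> _ /imfsetP[x /= xA ->]; exact: map_f.
Qed.

Lemma card_big_fset_add {G : zmodType} {I : Type} (r : seq I)
    (A : I -> {fset G}) :
  (#|` \big[@fset_add G/[fset 0%R]%fset]_(i <- r) A i|
     <= \prod_(i <- r) #|` A i|)%N.
Proof.
elim: r => [|i r IH]; first by rewrite !big_nil cardfs1.
rewrite !big_cons (leq_trans (card_fset_add _ _))// leq_mul2l IH orbT //.
Qed.

Lemma mem_big_fset_add {G : zmodType} {I : Type} (r : seq I)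
    (A : I -> {fset G}) (g : I -> G) :
  (forall i, g i \in A i) ->
  \sum_(i <- r) g i \in \big[@fset_add G/[fset 0%R]%fset]_(i <- r) A i.
Proof.
move=> gA; elim: r => [|i r IH]; first by rewrite !big_nil fset11.
by rewrite !big_cons mem_fset_add.
Qed.

Lemma iter_additive_sum {G : zmodType} (phi : {additive G -> G}) (k : nat)
    (I : Type) (r : seq I) (P : pred I) (g : I -> G) :
  iter k phi (\sum_(i <- r | P i) g i) = \sum_(i <- r | P i) iter k phi (g i).
Proof. by elim: k => //= k ->; rewrite raddf_sum. Qed.

Lemma iter_additiveD {G : zmodType} (phi : {additive G -> G}) (k : nat) x y :
  iter k phi (x + y) = iter k phi x + iter k phi y.
Proof. by elim: k => //= k ->; rewrite raddfD. Qed.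

Lemma iter_additive0 {G : zmodType} (phi : {additive G -> G}) (k : nat) :
  iter k phi 0 = 0.
Proof. by elim: k => //= k ->; rewrite raddf0. Qed.

Lemma iter_additiveMz {G : zmodType} (phi : {additive G -> G}) (k : nat) x m :
  iter k phi (x *~ m) = iter k phi x *~ m.
Proof. by elim: k => //= k ->; rewrite raddfMz. Qed.

Lemma trajectoryP {G : zmodType} {phi : {additive G -> G}} {F : {fset G}}
    {n : nat} {x : G} : F != fset0 ->
  (x \in trajectory phi F n) <->
  (exists2 g : nat -> G, (forall i, g i \in F) &
     x = \sum_(i < n) iter i phi (g i)).
Proof.
move=> /fset0Pn[f0 f0F]; split; last first.
  by move=> [g gF ->]; apply: mem_big_fset_add => i; apply: in_imfset; exact: gF.
elim: n x => [|n IH] x; rewrite /trajectory.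
  by rewrite big_ord0 => /fset1P->; exists (fun=> f0); rewrite ?big_ord0.
rewrite big_ord_recr => /fset_addP[y /IH[g gF ->] [z /imfsetP[/= f fF ->] ->]].
exists (fun i => if i == n then f else g i).
  by move=> i; case: ifP.
rewrite big_ord_recr /= eqxx; congr (_ + _); apply: eq_bigr => i _.
by rewrite ltn_eqF.
Qed.

(** The cocycle identity behind both the submultiplicativity and the
    monotonicity of [tau]. *)
Lemma trajectory_add {G : zmodType} (phi : {additive G -> G}) (F : {fset G})
    (m n : nat) : F != fset0 ->
  trajectory phi F (m + n) =
  fset_add (trajectory phi F m) [fset iter m phi y | y in trajectory phi F n]%fset.
Proof.
move=> F0; apply/fsetP => x; apply/idP/fset_addP.
- move=> /(trajectoryP F0)[g gF ->].
  rewrite big_split_ord /=; exists (\sum_(i < m) iter i phi (g i)).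
    by apply/(trajectoryP F0); exists g.
  exists (\sum_(i < n) iter (m + i) phi (g (m + i)%N)) => //.
  apply/imfsetP; exists (\sum_(i < n) iter i phi (g (m + i)%N)).
    by apply/(trajectoryP F0); exists (fun i => g (m + i)%N).
  by rewrite iter_additive_sum; apply: eq_bigr => i _; rewrite iterD.
- move=> [y /(trajectoryP F0)[g gF ->]].
  move=> [_ /imfsetP[z /= /(trajectoryP F0)[h hF ->] ->] ->].
  apply/(trajectoryP F0).
  exists (fun i => if (i < m)%N then g i else h (i - m)%N).
    by move=> i; case: ifP.
  rewrite big_split_ord /=; congr (_ + _).
    by apply: eq_bigr => i _; rewrite ltn_ord.
  rewrite iter_additive_sum; apply: eq_bigr => i _.
  by rewrite ltnNge leq_addr addKn iterD.
Qed.

Lemma trajectory_neq0 {G : zmodType} (phi : {additive G -> G}) (F : {fset G}) n :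
  F != fset0 -> trajectory phi F n != fset0.
Proof.
move=> F0; have /fset0Pn[f fF] := F0; apply/fset0Pn.
by exists (\sum_(i < n) iter i phi f); apply/(trajectoryP F0); exists (fun=> f).
Qed.

Lemma tau_gt0 {G : zmodType} (phi : {additive G -> G}) (F : {fset G}) n :
  F != fset0 -> (0 < tau phi F n)%N.
Proof. by move=> F0; rewrite cardfs_gt0 trajectory_neq0. Qed.

Lemma tau_submul {G : zmodType} (phi : {additive G -> G}) (F : {fset G}) m n :
  F != fset0 -> (tau phi F (m + n) <= tau phi F m * tau phi F n)%N.
Proof.
move=> F0; rewrite /tau trajectory_add // (leq_trans (card_fset_add _ _)) //.
by rewrite leq_mul2l leq_card_image orbT.
Qed.

Lemma tau_homo {G : zmodType} (phi : {additive G -> G}) (F : {fset G}) m n :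
  F != fset0 -> (m <= n)%N -> (tau phi F m <= tau phi F n)%N.
Proof.
move=> F0 mn; rewrite -(subnKC mn) /tau trajectory_add //.
have /fset0Pn[y yT] := trajectory_neq0 phi F (n - m) F0.
by apply: (leq_card_fset_addr (b := iter m phi y)); apply: in_imfset.
Qed.

Lemma tau0 {G : zmodType} (phi : {additive G -> G}) (F : {fset G}) :
  tau phi F 0 = 1%N.
Proof. by rewrite /tau /trajectory big_ord0 cardfs1. Qed.

(** * Reduction to the pairs [{0, f - f0}] *)

Lemma pair_neq0 {G : zmodType} (g : G) : [fset 0; g]%fset != fset0.
Proof. by apply/fset0Pn; exists 0; rewrite fset21. Qed.

(** Adding the translation [\sum_i phi^i f0] moves the trajectory of the pair
    into that of [F], since both [0 + f0] and [(f - f0) + f0] belong to [F]. *)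
Lemma tau_pair_le {G : zmodType} (phi : {additive G -> G}) (F : {fset G})
    (f0 f : G) n : f0 \in F -> f \in F ->
  (tau phi [fset 0%R; (f - f0)%R]%fset n <= tau phi F n)%N.
Proof.
move=> f0F fF; have F0 : F != fset0 by apply/fset0Pn; exists f0.
pose c := \sum_(i < n) iter i phi f0.
have <- : #|` [fset (x + c)%R | x in trajectory phi [fset 0%R; (f - f0)%R]%fset n]%fset|
   = tau phi [fset 0%R; (f - f0)%R]%fset n by apply: card_imfset; exact: addIr.
apply: fsubset_leq_card; apply/fsubsetP => _ /imfsetP[x /= + ->].
move=> /(trajectoryP (pair_neq0 _))[g gF ->].
apply/(trajectoryP F0); exists (fun i => g i + f0).
  by move=> i; have /fset2P[->|->] := gF i; rewrite ?add0r ?subrK.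
by rewrite -big_split; apply: eq_bigr => i _; rewrite iter_additiveD.
Qed.

(** After removing the same translation, an element [\sum_i phi^i (g i)] is
    sorted by the value of [g i]: the indices with [g i = f] contribute an
    element of the trajectory of the pair attached to [f]. *)
Lemma tau_le_prod {G : zmodType} (phi : {additive G -> G}) (F : {fset G})
    (f0 : G) n : f0 \in F ->
  (tau phi F n <= \prod_(f <- enum_fset F) tau phi [fset 0%R; (f - f0)%R]%fset n)%N.
Proof.
move=> f0F; have F0 : F != fset0 by apply/fset0Pn; exists f0.
apply: leq_trans (card_big_fset_add _ _).
set S := \big[_/_]_(_ <- _) _; pose c := \sum_(i < n) iter i phi f0.
have <- : #|` [fset (x + c)%R | x in S]%fset| = #|` S|.
  by apply: card_imfset; exact: addIr.
apply: fsubset_leq_card; apply/fsubsetP => _ /(trajectoryP F0)[g gF ->].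
apply/imfsetP; pose d f i := if g i == f then f - f0 else 0.
exists (\sum_(f <- enum_fset F) \sum_(i < n) iter i phi (d f i)) => /=.
  apply: mem_big_fset_add => f; apply/(trajectoryP (pair_neq0 _)).
  exists (d f) => // i; rewrite /d; case: ifP => _; first exact: fset22.
  exact: fset21.
rewrite exchange_big -big_split; apply: eq_bigr => i _ /=.
rewrite -iter_additive_sum -iter_additiveD; congr iter.
rewrite (big_rem (g i)) ?gF //= /d eqxx big1_seq ?addr0 ?subrK // => f.
move=> /andP[_]; rewrite mem_rem_uniq ?fset_uniq // inE => /andP[ne _].
by rewrite eq_sym (negbTE ne).
Qed.

(** * Evaluating integer polynomials at an endomorphism *)

Definition ev {G : zmodType} (phi : {additive G -> G}) (g : G)
    (h : {poly int}) : G := \sum_(i < size h) iter i phi g *~ h`_i.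

Lemma ev_widen {G : zmodType} (phi : {additive G -> G}) g (h : {poly int}) n :
  (size h <= n)%N -> ev phi g h = \sum_(i < n) iter i phi g *~ h`_i.
Proof.
move=> hn; rewrite /ev (big_ord_widen n (fun i => iter i phi g *~ h`_i)) //.
rewrite big_mkcond; apply: eq_bigr => i _; case: ltnP => // hi.
by rewrite nth_default // mulr0z.
Qed.

Fact ev_is_zmod_morphism {G : zmodType} (phi : {additive G -> G}) g :
  zmod_morphism (ev phi g).
Proof.
move=> h s; set n := maxn (size h) (size s).
rewrite !(@ev_widen _ _ _ _ n) ?leq_maxl ?leq_maxr //; last first.
  by rewrite (leq_trans (size_polyD _ _)) // size_polyN.
by rewrite -sumrB; apply: eq_bigr => i _; rewrite coefB mulrzBr.
Qed.

HB.instance Definition _ (G : zmodType) (phi : {additive G -> G}) (g : G) :=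
  GRing.isZmodMorphism.Build {poly int} G (ev phi g) (ev_is_zmod_morphism phi g).

Lemma ev0l {G : zmodType} (phi : {additive G -> G}) (h : {poly int}) :
  ev phi 0 h = 0.
Proof. by rewrite /ev big1 // => i _; rewrite iter_additive0 mul0rz. Qed.

Lemma evZ {G : zmodType} (phi : {additive G -> G}) g c (h : {poly int}) :
  ev phi g (c *: h) = ev phi g h *~ c.
Proof.
rewrite (@ev_widen _ _ _ _ (size h)) ?size_scale_leq // /ev mulrz_suml.
by apply: eq_bigr => i _; rewrite coefZ mulrzA_C.
Qed.

Lemma evMX {G : zmodType} (phi : {additive G -> G}) g (h : {poly int}) :
  ev phi g (h * 'X) = phi (ev phi g h).
Proof.
rewrite (@ev_widen _ _ _ _ (size h).+1); last first.
  by have [->|/size_mulX->] := eqVneq h 0; rewrite // mul0r size_poly0.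
rewrite big_ord_recl coefMX /= mulr0z add0r raddf_sum; apply: eq_bigr => i _.
by rewrite coefMX /= raddfMz.
Qed.

Lemma evXn {G : zmodType} (phi : {additive G -> G}) g n :
  ev phi g 'X^n = iter n phi g.
Proof.
elim: n => [|n IH]; last by rewrite exprSr evMX IH.
by rewrite expr0 /ev size_poly1 big_ord1 coef1.
Qed.

(** Polynomials in [phi] compose multiplicatively: [h * s] acts on [g] as [s]
    acts on the image of [g] under [h]. *)
Lemma evM {G : zmodType} (phi : {additive G -> G}) g (h s : {poly int}) :
  ev phi g (h * s) = ev phi (ev phi g h) s.
Proof.
elim/poly_ind: s => [|s c IH]; first by rewrite mulr0 !raddf0.
rewrite mulrDr mulrA !raddfD /= !evMX IH; congr (_ + _).
rewrite -[c%:P in RHS]alg_polyC evZ -[1](expr0 'X) evXn /=.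
by rewrite mulrC mul_polyC evZ.
Qed.

(** * Few partial sums force an annihilating polynomial *)

(** Between two multiples of [k] the summand [0] is chosen. *)
Lemma sub_sum_in_trajectory {G : zmodType} (phi : {additive G -> G}) g k n
    (e : nat -> bool) : (0 < k)%N ->
  \sum_(i < n) (if e i then iter (k * i) phi g else 0)
    \in trajectory phi [fset 0; g]%fset (k * n).
Proof.
move=> k0; have F0 := pair_neq0 g; elim: n => [|n IH].
  by rewrite muln0 /trajectory !big_ord0 fset11.
rewrite mulnSr trajectory_add // big_ord_recr /=; apply: mem_fset_add => //.
apply/imfsetP; exists (if e n then g else 0) => /=; last first.
  by case: ifP => //; rewrite iter_additive0.
case: k k0 {IH} => // k _; apply/(trajectoryP F0).
exists (fun i => if i == 0%N then if e n then g else 0 else 0).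
  by move=> i; do 2?[case: ifP => _]; rewrite ?fset21 ?fset22.
by rewrite big_ord_recl big1 ?addr0 // => i _; rewrite iter_additive0.
Qed.

(** Composing with ['X^k] makes [h] a relation between the iterates of
    [phi^k]. *)
Definition small_annihilator {G : zmodType} (phi : {additive G -> G}) (g : G)
    (k : nat) :=
  exists h : {poly int}, [/\ h != 0, forall i, (`|(h`_i)%R| <= 1)%N &
     ev phi g (h \Po 'X^k) = 0].

(** Pigeonhole: the [2 ^ n] sums over subsets of [{phi^(k i) g : i < n}]
    cannot be distinct, and the difference of two indicator functions
    provides the polynomial. *)
Lemma small_annihilatorP {G : zmodType} (phi : {additive G -> G}) g k n :
  (0 < k)%N -> (tau phi [fset 0%R; g]%fset (k * n) < 2 ^ n)%N ->
  small_annihilator phi g k.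
Proof.
move=> k0; rewrite ltnNge => tau_lt.
pose v (t : n.-tuple bool) :=
  \sum_(i < n) (if nth false t i then iter (k * i) phi g else 0).
have /injectivePn[t [t' tt' vv]] : ~~ injectiveb v.
  apply: contra tau_lt => /injectiveP v_inj.
  have <- : size [seq v t | t : n.-tuple bool] = (2 ^ n)%N.
    by rewrite size_map -cardE card_tuple card_bool.
  apply: uniq_leq_size; first by rewrite map_inj_uniq // enum_uniq.
  by move=> _ /mapP[t _ ->]; exact: sub_sum_in_trajectory.
pose c i : int := (nth false t i)%:Z - (nth false t' i)%:Z.
exists (\poly_(i < n) c i); split.
- apply: contra tt' => /eqP h0; apply/eqP/val_inj.
  apply: (@eq_from_nth _ false); rewrite !size_tuple // => i ni.
  have := congr1 (fun h : {poly int} => h`_i) h0.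
  by rewrite coef_poly ni coef0 /c; do 2!case: (nth _ _ _).
- by move=> i; rewrite coef_poly; case: ifP => // _; rewrite /c; do 2!case: (nth _ _ _).
- rewrite poly_def raddf_sum raddf_sum /=.
  apply: (@etrans _ _ (v t - v t')); last by rewrite vv subrr.
  rewrite /v -sumrB; apply: eq_bigr => i _.
  rewrite comp_polyZ comp_Xn_poly evZ -exprM evXn /c.
  by do 2!case: (nth _ _ _); rewrite ?subrr ?subr0 ?sub0r ?mulr0z ?mulr1z ?mulrN1z.
Qed.

(** * Roots of polynomials with small coefficients *)

Lemma geom_sum_lt {R : numDomainType} (x : R) n : 2 <= x ->
  \sum_(i < n) x ^+ i < x ^+ n.
Proof.
move=> x2; have x0 : 0 <= x by rewrite (le_trans _ x2).
elim: n => [|n IH]; first by rewrite big_ord0 expr0.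
rewrite big_ord_recr exprS /=.
apply: (lt_le_trans (y := 2 * x ^+ n)); last by rewrite ler_wpM2r ?exprn_ge0.
by rewrite mulr_natl mulr2n ltrD2r.
Qed.

(** For [`|z| >= 2] the leading term dominates the sum of all the others. *)
Lemma root_small_poly_lt2 (h : {poly int}) (z : algC) :
  h != 0 -> (forall i, `|(h`_i)%R|%N <= 1)%N -> root (map_poly intr h) z ->
  `|z| < 2.
Proof.
move=> h0 h1 /eqP hz; rewrite real_ltNge ?normr_real ?realn //.
apply/negP => z2; have := geom_sum_lt (`|z|) (size h).-1 z2.
apply/negP; rewrite -real_leNgt; last 2 first.
- by rewrite rpredX ?normr_real.
- by rewrite rpred_sum // => i _; rewrite rpredX ?normr_real.
have hs : (size h).-1.+1 = size h by rewrite prednK // size_poly_gt0.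
have norm_int (m : int) : `|m%:~R : algC| = (`|m|%N)%:R.
  by rewrite pmulrn abszE intr_norm.
move: hz; rewrite (@horner_coef_wide _ (size h)) ?size_poly //.
rewrite -hs big_ord_recr /= coef_map => /eqP; rewrite addrC addr_eq0 => /eqP hz.
have : `|z| ^+ (size h).-1 <= `|(h`_(size h).-1)%:~R * z ^+ (size h).-1|.
  rewrite normrM normrX ler_peMl ?exprn_ge0 // norm_int ler1n.
  by rewrite absz_gt0 -lead_coefE lead_coef_eq0.
move=> /le_trans; apply; rewrite hz normrN; apply: (le_trans (ler_norm_sum _ _ _)).
apply: ler_sum => i _; rewrite coef_map normrM normrX ler_piMl ?exprn_ge0 //.
by rewrite norm_int lern1.
Qed.

(** Bernoulli's inequality: powers of a number above [1] are unbounded. *)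
Lemma norm_le1_of_powers (z : algC) : (forall k, (0 < k)%N -> `|z| ^+ k < 2) ->
  `|z| <= 1.
Proof.
move=> zk; rewrite real_leNgt ?normr_real ?real1 //; apply/negP => z1.
have d0 : 0 < `|z| - 1 by rewrite subr_gt0.
pose k := (Num.bound (`|z| - 1)^-1).+1.
have hk : 1 <= k%:R * (`|z| - 1).
  rewrite -ler_pdivrMr // mul1r; apply/ltW.
  by rewrite (lt_trans (archi_boundP _)) ?invr_ge0 ?ltW // ltr_nat.
have bern n : 1 + n%:R * (`|z| - 1) <= `|z| ^+ n.
  elim: n => [|n IH]; first by rewrite mul0r addr0.
  rewrite exprS; apply: le_trans (ler_wpM2l (normr_ge0 z) IH).
  rewrite -subr_ge0 -natr1.
  have -> : `|z| * (1 + n%:R * (`|z| - 1)) - (1 + (n%:R + 1) * (`|z| - 1)) =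
    n%:R * (`|z| - 1) * (`|z| - 1) by ring.
  by rewrite !mulr_ge0 ?(ltW d0).
have := lt_le_trans (zk k isT) (lerD (lexx 1) hk).
by move=> /(le_lt_trans (bern k)); rewrite ltxx.
Qed.

(** * Linear recurrences without roots outside the unit disc *)

(** [L] stands for a sequence [n |-> L 'X^n], and the last hypothesis for
    a linear recurrence with characteristic roots [rs].  Splitting off a root
    [z], the form [L'] below obeys the recurrence for the remaining roots, and
    [L 'X^(n + 1) = z * L 'X^n + L' 'X^n] with [`|z| <= 1]: each root costs one
    summation, that is one power of [n]. *)
Lemma linear_form_bound {R : numDomainType} (rs : seq R) (L : {poly R} -> R) :
  (forall a u v, L (a *: u + v) = a * L u + L v) ->
  {in rs, forall z, `|z| <= 1} ->
  (forall h, L (h * \prod_(z <- rs) ('X - z%:P)) = 0) ->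
  exists2 C : R, 0 <= C & forall n, `|L 'X^n| <= C * n.+1%:R ^+ size rs.
Proof.
elim: rs L => [|z rs IH] L Llin rs1 Lker.
  by exists 0 => // n; move: (Lker 'X^n); rewrite big_nil mulr1 => ->; rewrite normr0 mul0r.
pose L' h := L (h * ('X - z%:P)).
have [||h|C C0 LC] := IH L'.
- by move=> a u v; rewrite /L' mulrDl -scalerAl Llin.
- by move=> y yrs; apply: rs1; rewrite inE yrs orbT.
- by rewrite /L' -mulrA (mulrC _ ('X - _)) mulrA -mulrA -(Lker h) big_cons mulrA.
exists (`|L 1| + C) => [|n]; first by rewrite addr_ge0.
set s := size rs; rewrite -/s in LC.
have Lrec m : L 'X^(m.+1) = L' 'X^m + z * L 'X^m.
  rewrite [RHS]addrC -Llin; congr L.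
  by rewrite mulrBr -exprSr [_ * z%:P]mulrC mul_polyC addrC subrK.
have : `|L 'X^n| <= `|L 1| + C * n%:R * n.+1%:R ^+ s.
  elim: n => [|n IHn]; first by rewrite mulr0 mul0r addr0 expr0.
  rewrite Lrec (le_trans (ler_normD _ _)) //.
  have z1 : `|z| <= 1 by apply: rs1; rewrite inE eqxx.
  have : `|z * L 'X^n| <= `|L 'X^n| by rewrite normrM ler_piMl.
  move=> /le_trans/(_ IHn)/(lerD (LC n)) /le_trans; apply.
  rewrite addrCA lerD2l -mulrA -mulrDr -mulrA ler_wpM2l //.
  rewrite -[X in X + _]mul1r -mulrDl addrC natr1 ler_wpM2l //.
  by rewrite lerXn2r ?nnegrE ?ler_nat.
move=> /le_trans; apply; rewrite mulrDl lerD //.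
  by rewrite ler_peMr // exprn_ege1 // ler1n.
by rewrite -mulrA ler_wpM2l // [leRHS]exprS ler_wpM2r ?exprn_ge0 // ler_nat.
Qed.

(** The form [L] of [linear_form_bound] is a coefficient of the remainder
    modulo [q], taken over the algebraic numbers, where [q] splits. *)
Lemma modXn_bound (q : {poly int}) : lead_coef q \is a GRing.unit ->
  (forall z : algC, root (map_poly intr q) z -> `|z| <= 1) ->
  exists C e, forall n j, (`|(('X^n %% q)`_j)%R| <= C * n.+1 ^ e)%N.
Proof.
move=> qU q_roots; pose Q : {poly algC} := map_poly intr q.
have q0 : q != 0 by apply: contraTneq qU => ->; rewrite lead_coef0 unitr0.
have intr_inj' : injective (intr : int -> algC) by exact: intr_inj.
have sQ : size Q = size q by rewrite size_map_inj_poly.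
have Q0 : Q != 0 by rewrite -size_poly_gt0 sQ size_poly_gt0.
have [rs Qrs] := closed_field_poly_normal Q.
have lQ : lead_coef Q != 0 by rewrite lead_coef_eq0.
have rs1 : {in rs, forall z, `|z| <= 1}.
  move=> z zrs; apply: q_roots; rewrite -/Q Qrs rootZ //.
  by rewrite root_prod_XsubC.
have coefC j : exists C, forall n,
    (`|(('X^n %% q)`_j)%R| <= C * n.+1 ^ size rs)%N.
  pose L (h : {poly algC}) := (h %% Q)`_j.
  have [||h|C C0 LC] := @linear_form_bound _ rs L.
  - by move=> a u v; rewrite /L modpD modpZl coefD coefZ.
  - by [].
  - rewrite /L modp_eq0 ?coef0 // dvdp_mull // Qrs.
    by rewrite dvdpZl.
  have [m Cm] : exists m : nat, C <= m%:R.
    by exists (Num.bound C); apply/ltW/archi_boundP.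
  exists m => n; rewrite -(ler_nat algC) natrM natrX.
  apply: (le_trans (y := `|L 'X^n|)); last first.
    by rewrite (le_trans (LC n)) // ler_wpM2r // exprn_ge0.
  rewrite pmulrn abszE intr_norm -coef_map /=.
  suff -> : L 'X^n = (map_poly intr ('X^n %% q) : {poly algC})`_j by [].
  rewrite /L -(@modpP _ 'X^n (map_poly intr ('X^n %/ q)) Q
                 (map_poly intr ('X^n %% q))) //.
    rewrite -rmorphM -rmorphD -Pdiv.IdomainUnit.divp_eq //.
    by rewrite rmorphXn /= map_polyX.
  by rewrite sQ size_map_inj_poly // ltn_modp.
have [C HC] := choice coefC.
exists (\sum_(j < size q) C j)%N, (size rs) => n j.
have [jq|jq] := ltnP j (size q); last first.
  by rewrite nth_default // (leq_trans _ jq) // ltnW // ltn_modp.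
rewrite (leq_trans (HC j n)) // leq_mul2r; apply/orP; right.
by rewrite (bigD1 (Ordinal jq)) //= leq_addr.
Qed.

(** * Annihilators of a single element *)

Lemma int_unit_of_small (m : int) :
  m != 0 -> (`|m| <= 1)%N -> m \is a GRing.unit.
Proof.
move=> m0 m1; have [->|->] : m = 1 \/ m = -1 by lia.
  exact: unitr1.
exact: unitrN1.
Qed.

(** The annihilator of [g] need not be principal, but pseudo-division by an
    element of least degree leaves a remainder which still kills [g], hence
    vanishes. *)
Lemma minimal_annihilator {G : zmodType} (phi : {additive G -> G}) g
    (h : {poly int}) : h != 0 -> ev phi g h = 0 ->
  exists q, [/\ q != 0, ev phi g q = 0 &
    forall s, ev phi g s = 0 -> q %| s].
Proof.
move=> h0 evh.
pose A n := `[< exists q : {poly int}, [/\ q != 0, ev phi g q = 0 & size q = n] >].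
have exA : exists n, A n by exists (size h); apply/asboolP; exists h.
case: (ex_minnP exA) => n /asboolP[q [q0 evq sq]] n_min.
exists q; split => // s evs; apply/modp_eq0P/eqP; apply/negPn/negP => r0.
suff /n_min : A (size (s %% q)) by rewrite leqNgt -sq ltn_modp q0.
apply/asboolP; exists (s %% q); split=> //.
have := Pdiv.Idomain.divp_eq s q; move/(congr1 (ev phi g)).
by rewrite raddfD /= evZ evs mul0rz mulrC evM evq ev0l add0r.
Qed.

(** [q] is the primitive part and [c] the content of a minimal annihilator:
    [q] controls [g] up to [c]-torsion.  By Gauss's lemma [q] divides every
    annihilator over the integers, in particular [p], whose leading
    coefficient is [1] or [-1], and those in ['X^k], whose roots are close to
    the unit disc for large [k]. *)
Lemma annihilator_structure {G : zmodType} (phi : {additive G -> G}) g :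
  (forall k, (0 < k)%N -> small_annihilator phi g k) ->
  exists (q p : {poly int}) (c : int),
    [/\ lead_coef q \is a GRing.unit,
        forall z : algC, root (map_poly intr q) z -> `|z| <= 1,
        lead_coef p \is a GRing.unit, ev phi g p = 0 &
        c != 0 /\ ev phi g q *~ c = 0].
Proof.
move=> small; have [p [p0 p1 evp]] := small 1%N isT.
rewrite expr1 comp_polyXr in evp.
have [q [q0 evq q_min]] := minimal_annihilator phi g p p0 evp.
have pU : lead_coef p \is a GRing.unit.
  by apply: int_unit_of_small; rewrite ?lead_coef_eq0 // lead_coefE.
exists (zprimitive q), p, (zcontents q); split => //.
- have [r pr] := dvdpP_int (q_min p evp).
  by move: pU; rewrite pr lead_coefM unitrM => /andP[].
- move=> z qz; apply: norm_le1_of_powers => k k0.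
  have [h [h0 h1 evh]] := small k k0.
  rewrite -normrX; apply: (root_small_poly_lt2 h) => //.
  have [r hr] := dvdpP_int (q_min _ evh).
  have : root (map_poly intr (h \Po 'X^k)) z.
    by rewrite hr rmorphM rootM qz.
  by rewrite map_comp_poly /= map_polyXn /root horner_comp hornerXn.
- by rewrite zcontents_eq0 -evZ -zpolyEprim.
Qed.

(** * Counting *)

(** Counting coefficient vectors without asking the [u i] to be independent:
    the box is a sum of [m] sets of size at most [2 * B + 1]. *)
Lemma box_cover {G : zmodType} (u : nat -> G) (m B : nat) :
  exists S : {fset G}, (#|` S| <= (2 * B + 1) ^ m)%N /\
    forall z : nat -> int, (forall i, `|z i|%N <= B)%N ->
      \sum_(i < m) u i *~ z i \in S.
Proof.
pose s := [seq a%:Z - B%:Z | a <- iota 0 (2 * B + 1)].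
pose A (i : 'I_m) := [fset u i *~ a | a in s]%fset.
exists (\big[@fset_add G/[fset 0%R]%fset]_(i < m) A i); split.
  rewrite (leq_trans (card_big_fset_add _ _)) //.
  rewrite -[X in (_ ^ X)%N]card_ord -prod_nat_const; apply: leq_prod => i _.
  have -> : (2 * B + 1 = size [seq u i *~ a | a <- s])%N.
    by rewrite !size_map size_iota.
  apply: uniq_leq_size; first exact: fset_uniq.
  by move=> _ /imfsetP[a /= aA ->]; exact: map_f.
move=> z zB; apply: mem_big_fset_add => i; apply/imfsetP.
exists (z i) => //=; apply/mapP; have := zB i.
exists (absz (z i + B%:Z)); last by lia.
by rewrite mem_iota; lia.
Qed.

(** The shift to [n.+1] keeps the bound positive at [n = 0], where [tau] is
    [1]. *)
Definition poly_bounded (f : nat -> nat) :=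
  exists C e, forall n, (f n <= C * n.+1 ^ e)%N.

Lemma poly_bounded_prod {I : Type} (r : seq I) (f : I -> nat -> nat) :
  (forall i, poly_bounded (f i)) ->
  poly_bounded (fun n => \prod_(i <- r) f i n)%N.
Proof.
move=> fP; elim: r => [|i r [C [e IH]]].
  by exists 1%N, 0%N => n; rewrite big_nil.
have [D [d fD]] := fP i; exists (D * C)%N, (d + e)%N => n.
by rewrite big_cons expnD mulnACA leq_mul.
Qed.

(** A partial sum is [h] applied to [g] for a polynomial [h] with coefficients
    in [{0, 1}].  Writing [h = r + q * s], the part [r] lies in a box of
    polynomial size by [modXn_bound], and the part [q * s] acts through
    [w = ev phi g q]; as [w] is killed by [p] and by [c], only the
    coefficients modulo [c] of [s] modulo [p] matter, and there are finitely
    many. *)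
Lemma tau_pair_poly_bounded {G : zmodType} (phi : {additive G -> G}) g :
  (forall k, (0 < k)%N -> small_annihilator phi g k) ->
  poly_bounded (tau phi [fset 0; g]%fset).
Proof.
move=> /annihilator_structure[q [p [c [qU q_roots pU evp [c0 evqc]]]]].
have [C [e HC]] := modXn_bound q qU q_roots.
pose w := ev phi g q.
have evw0 : ev phi w p = 0.
  by rewrite -evM mulrC evM evp ev0l.
have [S2 [S2card S2P]] := box_cover (fun j => iter j phi w) (size p) `|c|%N.
exists ((2 * C + 1) ^ size q * (2 * `|c| + 1) ^ size p)%N, (e.+1 * size q)%N => n.
have [S1 [S1card S1P]] :=
  box_cover (fun j => iter j phi g) (size q) (C * n.+1 ^ e.+1)%N.
apply: (@leq_trans (#|` fset_add S1 S2|)); last first.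
  apply: leq_trans (card_fset_add _ _) _; rewrite mulnAC leq_mul //.
  apply: leq_trans S1card _; rewrite expnM -expnMn.
  have [->|q0] := posnP (size q); first by rewrite !expn0.
  rewrite leq_exp2r // mulnDl mulnA leq_add2l mul1n.
  by rewrite expn_gt0.
apply: fsubset_leq_card; apply/fsubsetP => y.
move=> /(trajectoryP (pair_neq0 g))[f fF ->].
pose r := \sum_(i < n | f i == g) ('X^i %% q).
pose s := \sum_(i < n | f i == g) ('X^i %/ q).
have -> : \sum_(i < n) iter i phi (f i) = ev phi g r + ev phi w s.
  rewrite /w -evM -raddfD /=.
  have -> : r + q * s = \sum_(i < n | f i == g) 'X^i.
    rewrite /s mulr_sumr -big_split; apply: eq_bigr => i _ /=.
    by rewrite addrC mulrC -Pdiv.IdomainUnit.divp_eq.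
  rewrite raddf_sum [RHS]big_mkcond; apply: eq_bigr => i _ /=.
  rewrite evXn; case: eqP => [->//|fg].
  by have /fset2P[->|//] := fF i; rewrite iter_additive0.
apply: mem_fset_add.
- rewrite (ev_widen phi g r (size q)); last first.
    rewrite (leq_trans (size_sum _ _ _)) //; apply/bigmax_leqP => i _.
    by rewrite ltnW // ltn_modp; apply: contraTneq qU => ->; rewrite lead_coef0 unitr0.
  apply: S1P => j; rewrite coef_sum.
  have bnd (P : pred 'I_n) (F : 'I_n -> int) B : (forall i, `|F i| <= B)%N ->
      (`|(\sum_(i | P i) F i)%R| <= n * B)%N.
    move=> FB; rewrite -[X in (X * _)%N]card_ord -sum_nat_const.
    rewrite [X in (_ <= X)%N](bigID P) /=.
    apply: leq_trans (leq_addr _ _).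
    elim/big_ind2: _ => // a b a' b' ha ha'; lia.
  apply: leq_trans (bnd _ _ (C * n.+1 ^ e)%N _) _.
    move=> i; apply: leq_trans (HC i j) _; rewrite leq_mul2l; apply/orP; right.
    by case: (e) => [|d]; rewrite ?expn0 // leq_exp2r // ltnS ltnW.
  by rewrite mulnCA leq_mul2l expnS leq_mul2r leqnSn !orbT.
- have -> : ev phi w s = ev phi w (s %% p).
    rewrite {1}(Pdiv.IdomainUnit.divp_eq pU s) raddfD /= mulrC evM evw0.
    by rewrite ev0l add0r.
  rewrite (ev_widen phi w _ (size p)); last first.
    by rewrite ltnW // ltn_modp; apply: contraTneq pU => ->; rewrite lead_coef0 unitr0.
  have -> : \sum_(i < size p) iter i phi w *~ (s %% p)`_i =
            \sum_(i < size p) iter i phi w *~ ((s %% p)`_i %% c)%Z.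
    apply: eq_bigr => i _; rewrite {1}(divz_eq (s %% p)`_i c) mulrzDr.
    by rewrite -mulrzA_C -iter_additiveMz evqc iter_additive0 mul0rz add0r.
  apply: (S2P (fun i => ((s %% p)`_i %% c)%Z)) => i.
  have := ltz_mod ((s %% p)`_i) c0.
  by have := modz_ge0 ((s %% p)`_i) c0; lia.
Qed.

(** If [F] has no exponentially growing subsequence then neither does any of
    its pairs, so all pairs have small annihilators. *)
Lemma tau_dichotomy {G : zmodType} (phi : {additive G -> G}) (F : {fset G}) :
  F != fset0 ->
  (exists2 k, (0 < k)%N & forall n, (2 ^ n <= tau phi F (k * n))%N) \/
  poly_bounded (tau phi F).
Proof.
move=> /fset0Pn[f0 f0F].
have [|noexp] := pselect (exists2 k, (0 < k)%N &
  forall n, (2 ^ n <= tau phi F (k * n))%N); first by left.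
right.
have small f k : f \in F -> (0 < k)%N -> small_annihilator phi (f - f0) k.
  move=> fF k0; apply: contrapT => nosmall; apply: noexp; exists k => // n.
  apply: leq_trans (tau_pair_le phi F f0 f (k * n) f0F fF).
  by rewrite leqNgt; apply/negP => /(small_annihilatorP phi _ k n k0).
have [|C [e HC]] := @poly_bounded_prod _ (enum_fset F)
    (fun f => if f \in F then tau phi [fset 0; f - f0]%fset else fun=> 0%N).
  move=> f; case: ifP => fF; last by exists 0%N, 0%N.
  by apply: tau_pair_poly_bounded => k; exact: small.
exists C, e => n; apply: leq_trans (HC n).
rewrite (leq_trans (tau_le_prod phi F f0 n f0F)) // leq_eqVlt; apply/orP; left.
by apply/eqP/eq_big_seq => f fF; rewrite ifT.
Qed.

(** * Growth in the form of bounds by [C * (n + 1) ^ e] *)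

Lemma absz_sum_le {I : Type} (r : seq I) (F : I -> int) :
  (`|(\sum_(i <- r) F i)%R| <= \sum_(i <- r) `|F i|)%N.
Proof. by elim/big_ind2: _ => // a b a' b' ha ha'; lia. Qed.

Lemma polynomial_growthP {G : zmodType}
    (phi : {additive G -> G}) (F : {fset G}) :
  polynomial_growth phi F <-> poly_bounded (tau phi F).
Proof.
split=> [[P HP]|[C [e HC]]]; last first.
  exists (C%:Z *: ('X + 1) ^+ e) => n _.
  rewrite hornerZ horner_exp !hornerE.
  have -> : n%:Z + 1 = n.+1%:Z by lia.
  by rewrite -!natz -natrX -natrM ler_nat.
pose C := (\sum_(i < size P) `|(P`_i)%R|)%N.
exists C.+1, (size P) => -[|n]; first by rewrite tau0 exp1n muln1.
have := HP n.+1 isT; rewrite horner_coef => H.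
have {}H : (tau phi F n.+1 <=
    `|(\sum_(i < size P) P`_i * n.+1%:Z ^+ i)%R|)%N.
  by rewrite -lez_nat abszE (le_trans H) // ler_norm.
apply: (leq_trans H); apply: (leq_trans (absz_sum_le _ _)).
apply: (@leq_trans (C * n.+2 ^ size P)); last by rewrite leq_mul2r leqnSn orbT.
rewrite /C big_distrl; apply: leq_sum => i _ /=.
rewrite abszM abszX leq_mul2l; apply/orP; right.
apply: (@leq_trans (n.+2 ^ i)); last by rewrite leq_pexp2l // ltnW.
by case: (nat_of_ord i) => // d; rewrite leq_exp2r.
Qed.

(** The base [b] is [2 ^ (1 / 2k)] rather than [2 ^ (1 / k)], because [n] need
    not be a multiple of [k]: rounding down at most halves [n] once [n >= k],
    and for [n < k] the bound [tau 1 >= 2] is enough. *)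
Lemma exponential_growth_of_subsequence {R : realType} {G : zmodType}
    (phi : {additive G -> G}) (F : {fset G}) (k : nat) : F != fset0 ->
  (0 < k)%N -> (forall n, (2 ^ n <= tau phi F (k * n))%N) ->
  exponential_growth R phi F.
Proof.
move=> F0 k0 Hk; pose b : R := 2 `^ ((2 * k)%:R^-1).
have kR : ((2 * k)%:R : R) != 0 by rewrite pnatr_eq0; lia.
have b1 : 1 < b.
  have r0 : (0 : R) < (2 * k)%:R^-1 by rewrite invr_gt0 ltr0n muln_gt0.
  suff : 1 `^ (2 * k)%:R^-1 < b by rewrite powR1.
  by apply: gt0_ltr_powR => //; rewrite ?nnegrE // ltr1n.
have bk : b ^+ (2 * k) = 2.
  by rewrite -powR_mulrn ?powR_ge0 // -powRrM mulVf // powRr1.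
(* A trivial first step would make [tau] constant, by submultiplicativity. *)
have tau1 : (1 < tau phi F 1)%N.
  rewrite ltnNge; apply/negP => t1.
  have tle m : (tau phi F m <= 1)%N.
    elim: m => [|m IH]; first by rewrite tau0.
    rewrite -addn1; apply: leq_trans (tau_submul phi F m 1 F0) _.
    by rewrite -[1%N]muln1 leq_mul.
  by have := leq_trans (Hk 1%N) (tle _).
exists b; split => // n n0.
(* The maximum covers the indices [n < k]. *)
pose j := maxn 1 (n %/ k).
have nj : (n <= 2 * k * j)%N.
  have := ltn_ceil n k0; rewrite /j; nia.
apply: (le_trans (y := b ^+ (2 * k * j))).
  by rewrite ler_weXn2l // ltW.
rewrite exprM bk -natrX ler_nat /j.
have [jk|jk] := leqP (n %/ k) 1.
  by apply: leq_trans (tau_homo phi F 1 n F0 n0).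
apply: leq_trans (Hk _) _; apply: tau_homo => //.
by rewrite mulnC leq_trunc_div.
Qed.

(** * The entropy limit *)

Local Open Scope classical_set_scope.

(** Fekete's lemma: the limit is the infimum.  Euclidean division by an index
    [m] which nearly attains it bounds [u n / n] by [u m / m + M / n]. *)
Lemma fekete {R : realType} (u : nat -> R) : (forall n, 0 <= u n) ->
  (forall m n, u (m + n)%N <= u m + u n) ->
  cvgn (fun n => u n / n%:R).
Proof.
move=> u0 usub; pose S := [set u n / n%:R | n in [set n | (0 < n)%N]].
have Slb : has_lbound S.
  by exists 0 => _ [n _ <-]; rewrite divr_ge0.
have Sinf : has_inf S by split => //; exists (u 1%N / 1%:R); exists 1%N.
apply/cvg_ex; exists (inf S); apply/cvgrPdist_le => e e0.
have [_ [m /= m0 <-] um] := inf_adherent (divr_gt0 e0 (ltr0n R 2)) Sinf.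
have mR : (0 : R) < m%:R by rewrite ltr0n.
pose M := \sum_(r < m) u r.
have M0 : 0 <= M by apply: sumr_ge0.
have umul q r : u (q * m + r)%N <= q%:R * u m + u r.
  elim: q => [|q IH]; first by rewrite mul0n mul0r add0r.
  rewrite mulSn -addnA (le_trans (usub _ _)) // -natr1 mulrDl mul1r.
  by rewrite addrAC [leRHS]addrC lerD2l.
have ubound n : u n <= n%:R * (u m / m%:R) + M.
  rewrite {1}(divn_eq n m) (le_trans (umul _ _)) // lerD //.
    rewrite mulrCA mulrC ler_wpM2l // ler_pdivlMr // -natrM ler_nat.
    exact: leq_trunc_div.
  have rm : (n %% m < m)%N by rewrite ltn_mod.
  by rewrite /M (bigD1 (Ordinal rm)) //= lerDl sumr_ge0.
exists (Num.bound (M / (e / 2))).+1 => //= n /= nN.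
have n0 : (0 < n)%N by apply: leq_trans nN.
have nR : (0 : R) < n%:R by rewrite ltr0n.
have infle : inf S <= u n / n%:R by apply: ge_inf => //; exists n.
rewrite ler0_norm ?subr_le0 // opprB lerBlDl.
have : M / n%:R <= e / 2.
  rewrite ler_pdivrMr // mulrC -ler_pdivrMr ?divr_gt0 //.
  apply/ltW/(lt_le_trans (archi_boundP _)); first by rewrite divr_ge0 ?divr_ge0 // ltW.
  by rewrite ler_nat ltnW.
have : u n / n%:R <= u m / m%:R + M / n%:R.
  rewrite ler_pdivrMr // (le_trans (ubound n)) // mulrDl [in leRHS]mulrC.
  by rewrite divfK ?gt_eqF.
move=> h1 h2; lra.
Qed.

Lemma cvg_entropy {R : realType} {G : zmodType} (phi : {additive G -> G})
    (F : {fset G}) : F != fset0 ->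
  cvgn (fun n : nat => ln ((tau phi F n)%:R : R) / n%:R).
Proof.
move=> F0; have tau_ge1 n : 1 <= (tau phi F n)%:R :> R.
  by rewrite ler1n tau_gt0.
have tau_gt0R n : 0 < (tau phi F n)%:R :> R by rewrite ltr0n tau_gt0.
apply: (@fekete _ (fun n => ln (tau phi F n)%:R)) => [n|m n].
  by rewrite ln_ge0.
rewrite -lnM ?posrE // ler_ln ?posrE ?mulr_gt0 // -natrM ler_nat.
exact: tau_submul.
Qed.

Lemma entropy_gt0_of_exponential_growth {R : realType} {G : zmodType}
    (phi : {additive G -> G}) (F : {fset G}) : F != fset0 ->
  exponential_growth R phi F -> 0 < algebraic_entropy R phi F.
Proof.
move=> F0 [b [b1 bH]]; have b0 : 0 < b by apply: lt_trans b1.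
apply: (lt_le_trans (ln_gt0 b1)); apply: limr_ge; first exact: cvg_entropy.
exists 1%N => //= n n0; have nR : (0 : R) < n%:R by rewrite ltr0n.
rewrite ler_pdivlMr // mulr_natr -lnXn // ler_ln ?posrE ?exprn_gt0 //.
  exact: bH.
by rewrite ltr0n tau_gt0.
Qed.

(** The limit exists, so a subsequence suffices.  Along squares,
    [ln (m * m + 1) <= 2 * ln (m + 1) <= 2 * m], which is negligible with
    respect to [m * m]. *)
Lemma entropy_eq0_of_poly_bounded {R : realType} {G : zmodType}
    (phi : {additive G -> G}) (F : {fset G}) : F != fset0 ->
  poly_bounded (tau phi F) -> algebraic_entropy R phi F = 0.
Proof.
move=> F0 [C [e HC]]; have cvgH := cvg_entropy (R := R) phi F F0.
have tau_gt0R n : 0 < (tau phi F n)%:R :> R by rewrite ltr0n tau_gt0.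
set L := algebraic_entropy R phi F.
have L0 : 0 <= L.
  apply: limr_ge; first exact: cvgH.
  exists 0%N => // n _ /=.
  by rewrite divr_ge0 // ln_ge0 // ler1n tau_gt0.
apply/eqP; rewrite eq_le L0 andbT leNgt; apply/negP => Lpos.
have L2 : L / 2 < L by lra.
have [N _ HN] := cvgr_gt L cvgH (L / 2) L2.
pose K : R := ln C.+1%:R + e%:R * 2.
have K0 : 0 <= K by rewrite addr_ge0 ?mulr_ge0 ?ln_ge0 // ler1n.
(* Beyond [K / (L / 2)] the bound [K / m] on the ratio at [m * m] is at most
   [L / 2]. *)
pose m := maxn N.+1 (Num.bound (K / (L / 2))).
have m0 : (0 < m)%N by rewrite leq_max.
have mR : (0 : R) < m%:R by rewrite ltr0n.
have Nm : (N <= m * m)%N.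
  have : (N < m)%N by rewrite leq_max leqnn.
  by move=> Nm; rewrite (leq_trans (ltnW Nm)) // leq_pmulr.
have := HN (m * m)%N Nm; apply/negP; rewrite -leNgt.
have lntau : ln (tau phi F (m * m))%:R <= K * m%:R :> R.
  have tau_le : (tau phi F (m * m) <= C.+1 * m.+1 ^ (e * 2))%N.
    apply: leq_trans (HC _) _; rewrite leq_mul // mulnC expnM.
    by case: (e) => // d; rewrite leq_exp2r // expnS expn1 mulSn mulnS; lia.
  apply: (le_trans (y := ln (C.+1 * m.+1 ^ (e * 2))%:R)).
    by rewrite ler_ln ?posrE // ?ltr0n ?muln_gt0 ?expn_gt0 // ler_nat.
  rewrite natrM natrX lnM ?posrE ?exprn_gt0 ?ltr0n // lnXn ?ltr0n //.
  rewrite /K mulrDl; apply: lerD.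
    by rewrite ler_peMr ?ln_ge0 ?ler1n.
  rewrite -natrM -[leLHS]mulr_natl ler_wpM2l // -natr1 addrC.
  by apply: le_ln1Dx; apply: lt_le_trans (ltW mR); rewrite oppr_lt0.
rewrite natrM ler_pdivrMr ?mulr_gt0 // (le_trans lntau) // mulrA ler_wpM2r //.
have : K / (L / 2) <= m%:R.
  apply/ltW/(lt_le_trans (archi_boundP _)); first by rewrite !divr_ge0.
  by rewrite ler_nat leq_maxr.
by rewrite ler_pdivrMr ?divr_gt0 // mulrC.
Qed.

Local Close Scope classical_set_scope.

Theorem theorem6p13 (R : realType) (G : zmodType) (phi : {additive G -> G})
    (F : {fset G}) (F_neq0 : F != fset0) :
  (0 < algebraic_entropy R phi F <-> exponential_growth R phi F) /\
  (algebraic_entropy R phi F = 0 <-> polynomial_growth phi F).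
Proof.
have exp_gt0 := @entropy_gt0_of_exponential_growth R G phi F F_neq0.
have poly_eq0 := @entropy_eq0_of_poly_bounded R G phi F F_neq0.
rewrite polynomial_growthP.
have exp_or_poly : exponential_growth R phi F \/ poly_bounded (tau phi F).
  have [[k k0 Hk]|] := tau_dichotomy phi F F_neq0; last by right.
  by left; exact: exponential_growth_of_subsequence Hk.
split; split => // H; case: exp_or_poly => //.
- by move=> /poly_eq0 H0; move: H; rewrite H0 ltxx.
- by move=> /exp_gt0; rewrite H ltxx.
Qed.
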